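(* Let $n\ge1$ and let $g_1,\dots,g_n$ be the free generators of $\mathcal F_n$. The generic Kripke model $\mathfrak K_n=(K_n,\le,\mathrm{val})$ is, as a partial order, the principal ideal spectrum of $\mathcal F_n$ (equivalently, of $\widehat{\mathcal F_n}$) ordered by inclusion: the map sending $w\in K_n$ to the principal ideal generated by $K_n\setminus\{w\}^\uparrow$ is an isomorphism of partial orders from $(K_n,\le)$ onto $(\mathrm{Spec}^0_\downarrow(\mathcal F_n),\subseteq)$, and likewise onto $(\mathrm{Spec}^0_\downarrow(\widehat{\mathcal F_n}),\subseteq)$. Under this identification, the valuations are determined by the images $\bar I_0(g_j)$ of the free generators: for a principal prime ideal $\mathfrak i$ and $1\le j\le n$, one has $P_j\in\mathrm{val}(\mathfrak i)$ iff $g_j\notin\mathfrak i$, or equivalently, iff $\mathfrak i\in\bar I_0(g_j)$.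
   Context: Fix $n\ge1$ and symbols $P_1,\dots,P_n$. The generic Kripke model $\mathfrak K_n=(K_n,\le,\mathrm{val})$ consists of a partially ordered set $(K_n,\le)$ and a valuation map $\mathrm{val}:K_n\to\mathfrak P(\{P_1,\dots,P_n\})$; it is the increasing union of finite pieces $K_n^d$ ($d\ge 0$) built recursively: $K_n^{-1}=\emptyset$, and $K_n^d\setminus K_n^{d-1}$ consists of exactly one point $w_{\beta,Y}$ for each pair $(\beta,Y)$ such that (i) $Y$ is a decreasing subset of $K_n^{d-1}$ with $Y\not\subseteq K_n^{d-2}$ (for $d=0$ this last condition is void, so $Y=\emptyset$); (ii) $\beta\subseteq\{P_1,\dots,P_n\}$ and $\beta\subseteq\mathrm{val}(w')$ for all $w'\in Y$; (iii) if $Y$ is the decreasing set generated by a single element $w_{\beta',Y'}$, then $\beta\ne\beta'$. One sets $\mathrm{val}(w_{\beta,Y})=\beta$, and $w\le w_{\beta,Y}$ iff $w\in Y$ or $w=w_{\beta,Y}$. $\widehat{\mathcal F_n}:=\mathcal O_\downarrow(K_n,\le)$ is the Heyting algebra of all decreasing subsets of $K_n$ ($\sqcap=\cap$, $\sqcup=\cup$, $a\to b$ = the largest decreasing set contained in $(K_n\setminus a)\cup b$). By a theorem of Bellissima, the Heyting sub-algebra of $\widehat{\mathcal F_n}$ generated by $g_i=\{w\in K_n: P_i\in\mathrm{val}(w)\}$, $i=1,\dots,n$, is free on $g_1,\dots,g_n$; the free Heyting algebra $\mathcal F_n$ is identified with it. It contains all sets $K_n\setminus\{w\}^\uparrow$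 ($w\in K_n$), where $\{w\}^\uparrow=\{v\in K_n: v\ge w\}$. For a Heyting algebra $H$, a principal ideal is a set $(x)_\downarrow=\{y\in H: y\le x\}$ with $x\ne1$, $\mathrm{Spec}^0_\downarrow(H)$ is the set of all principal prime ideals, and $\bar I_0(a)=\{\mathfrak i\in\mathrm{Spec}^0_\downarrow(H)\mid a\notin\mathfrak i\}$ for $a\in H$. *)

(* Defs.v *)
From HB Require Import structures.
From mathcomp Require Import all_boot all_order finmap.
From mathcomp Require Import boolp classical_sets functions.

Set Implicit Arguments.
Unset Strict Implicit.
Unset Printing Implicit Defensive.

Import Order.TTheory.
Local Open Scope order_scope.
Local Open Scope classical_set_scope.

HB.mixin Record isHeyting d T of Order.TBLattice d T := {
  himp : T -> T -> T;
  himpP : forall a b c : T, (c <= himp a b) = (Order.meet c a <= b)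
}.

#[short(type="heytingType")]
HB.structure Definition Heyting d := { T of isHeyting d T & Order.TBLattice d T }.

Definition principal_ideal d (H : heytingType d) (x : H) : set H :=
  [set y | y <= x].

Definition ideal d (H : heytingType d) (I : set H) : Prop :=
  [/\ I \bot,
      forall a b : H, I a -> I b -> I (Order.join a b) &
      forall a b : H, a <= b -> I b -> I a].

Definition prime_ideal d (H : heytingType d) (I : set H) : Prop :=
  [/\ ideal I, ~ I \top &
      forall a b : H, I (Order.meet a b) -> I a \/ I b].

Definition Spec0 d (H : heytingType d) : set (set H) :=
  [set I | prime_ideal I /\ exists2 x : H, x <> \top & I = principal_ideal x].

Arguments Spec0 {d} H.

Definition Ibar0 d (H : heytingType d) (a : H) : set (set H) :=
  [set I | Spec0 H I /\ ~ I a].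

Definition heyting_closed d (H : heytingType d) (S : set H) : Prop :=
  [/\ S \bot, S \top,
      forall a b : H, S a -> S b -> S (Order.meet a b),
      forall a b : H, S a -> S b -> S (Order.join a b) &
      forall a b : H, S a -> S b -> S (himp a b)].

Definition gen_pred d (H : heytingType d) (A : set H) : {pred H} :=
  fun x => `[< smallest (@heyting_closed d H) A x >].

Record gen_subalg d (H : heytingType d) (A : set H) : Type := GenSubalg {
  gen_val : H;
  gen_valP : gen_val \in gen_pred A
}.
Arguments GenSubalg {d H A}.

HB.instance Definition _ d (H : heytingType d) (A : set H) :=
  [isSub for @gen_val d H A].
HB.instance Definition _ d (H : heytingType d) (A : set H) :=
  [Choice of gen_subalg A by <:].

Lemma gen_closed d (H : heytingType d) (A : set H) :
  heyting_closed (smallest (@heyting_closed d H) A).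
Proof.
split=> [S [[]]|S [[]]|a b Sa Sb S SP|a b Sa Sb S SP|a b Sa Sb S SP] //;
  have := Sb _ SP; have := Sa _ SP; case: SP => -[? ? hI hU hi] _ *.
- exact: hI.
- exact: hU.
- exact: hi.
Qed.

Lemma gen_meet d (H : heytingType d) (A : set H) :
  {in gen_pred A &, forall x y, Order.meet x y \in gen_pred A}.
Proof.
move=> x y /asboolP hx /asboolP hy; apply/asboolP.
by have [_ _ h _ _] := gen_closed A; apply: h.
Qed.

Lemma gen_join d (H : heytingType d) (A : set H) :
  {in gen_pred A &, forall x y, Order.join x y \in gen_pred A}.
Proof.
move=> x y /asboolP hx /asboolP hy; apply/asboolP.
by have [_ _ _ h _] := gen_closed A; apply: h.
Qed.

Lemma gen_bot d (H : heytingType d) (A : set H) : \bot \in gen_pred A.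
Proof. by apply/asboolP; have [] := gen_closed A. Qed.

Lemma gen_top d (H : heytingType d) (A : set H) : \top \in gen_pred A.
Proof. by apply/asboolP; have [] := gen_closed A. Qed.

HB.instance Definition _ d (H : heytingType d) (A : set H) :=
  Order.SubChoice_isTBSubLattice.Build d H (gen_pred A) d (gen_subalg A)
    (@gen_meet d H A) (@gen_join d H A) (@gen_bot d H A) (@gen_top d H A).

Lemma gen_himp_subproof d (H : heytingType d) (A : set H) (x y : gen_subalg A) :
  himp (gen_val x) (gen_val y) \in gen_pred A.
Proof.
apply/asboolP; have [_ _ _ _ h] := gen_closed A.
by apply: h; apply/asboolP; apply: gen_valP.
Qed.

Definition gen_himp d (H : heytingType d) (A : set H) (x y : gen_subalg A) :
  gen_subalg A := GenSubalg _ (gen_himp_subproof x y).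

Lemma gen_himpP d (H : heytingType d) (A : set H) (a b c : gen_subalg A) :
  (c <= gen_himp a b) = (Order.meet c a <= b).
Proof. by rewrite -!Order.le_val; apply: himpP. Qed.

HB.instance Definition _ d (H : heytingType d) (A : set H) :=
  isHeyting.Build d (gen_subalg A) (@gen_himpP d H A).

Lemma gen_sub_subproof d (H : heytingType d) (A : set H) (x : H) :
  A x -> x \in gen_pred A.
Proof. by move=> Ax; apply/asboolP; apply: sub_gen_smallest. Qed.

Definition gen_in d (H : heytingType d) (A : set H) (x : H) (Ax : A x) :
  gen_subalg A := GenSubalg x (gen_sub_subproof Ax).

Definition decreasing d (P : porderType d) (A : set P) : Prop :=
  forall x y : P, x <= y -> A y -> A x.

Definition decreasing_pred d (P : porderType d) : {pred set P} :=
  fun A => `[< decreasing A >].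

Record downset d (P : porderType d) : Type := Downset {
  down_val : set P;
  down_valP : down_val \in @decreasing_pred d P
}.
Arguments Downset {d P}.

HB.instance Definition _ d (P : porderType d) := [isSub for @down_val d P].
HB.instance Definition _ d (P : porderType d) := [Choice of downset P by <:].

Lemma decreasing_meet d (P : porderType d) :
  {in @decreasing_pred d P &, forall x y, Order.meet x y \in @decreasing_pred d P}.
Proof.
move=> A B /asboolP dA /asboolP dB; apply/asboolP => x y xy [Ay By].
by split; [apply: dA Ay|apply: dB By].
Qed.

Lemma decreasing_join d (P : porderType d) :
  {in @decreasing_pred d P &, forall x y, Order.join x y \in @decreasing_pred d P}.
Proof.
move=> A B /asboolP dA /asboolP dB; apply/asboolP => x y xy [Ay|By].
  by left; apply: dA Ay.
by right; apply: dB By.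
Qed.

Lemma decreasing_bot d (P : porderType d) : \bot \in @decreasing_pred d P.
Proof. by apply/asboolP. Qed.

Lemma decreasing_top d (P : porderType d) : \top \in @decreasing_pred d P.
Proof. by apply/asboolP. Qed.

HB.instance Definition _ d (P : porderType d) :=
  Order.SubChoice_isTBSubLattice.Build set_display (set P) (@decreasing_pred d P)
    set_display (downset P) (@decreasing_meet d P) (@decreasing_join d P)
    (@decreasing_bot d P) (@decreasing_top d P).

Definition down_himp_val d (P : porderType d) (a b : set P) : set P :=
  \bigcup_(c in [set c | decreasing c /\ c `<=` ~` a `|` b]) c.

Lemma down_himp_subproof d (P : porderType d) (a b : downset P) :
  down_himp_val (down_val a) (down_val b) \in @decreasing_pred d P.
Proof.
apply/asboolP => x y xy [c [dc sc] cy].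
by exists c => //; apply: dc xy cy.
Qed.

Definition down_himp d (P : porderType d) (a b : downset P) : downset P :=
  Downset _ (down_himp_subproof a b).

Lemma down_himpP d (P : porderType d) (a b c : downset P) :
  (c <= down_himp a b) = (Order.meet c a <= b).
Proof.
rewrite -!Order.le_val; apply/asboolP/asboolP => h x.
  by move=> [cx ax]; have [e [_ se] ex] := h _ cx; case: (se _ ex).
move=> cx; exists (down_val c) => //; split; first exact/asboolP/down_valP.
move=> y cy; have [ay|nay] := pselect (down_val a y); last by left.
by right; apply: h.
Qed.

HB.instance Definition _ d (P : porderType d) :=
  isHeyting.Build set_display (downset P) (@down_himpP d P).

Definition Up d (P : porderType d) (w : P) : set P := [set v | w <= v].

Lemma compl_Up_subproof d (P : porderType d) (w : P) :
  ~` Up w \in @decreasing_pred d P.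
Proof. by apply/asboolP => x y xy; apply: contra_not => wx; apply: le_trans xy. Qed.

Definition compl_Up d (P : porderType d) (w : P) : downset P :=
  Downset _ (compl_Up_subproof w).

(* The points of the generic Kripke model are natural numbers: w_{beta,Y} is the
   code of the pair (beta, Y), where Y is itself a finite set of codes. Since
   coding is injective, there is exactly one point for each pair. *)

Definition pcode n (b : {set 'I_n}) (Y : {fset nat}) : nat := choice.pickle (b, Y).

Definition pdecode n (x : nat) : {set 'I_n} * {fset nat} :=
  odflt (finset.set0, fset0) (choice.unpickle x).

Definition pval n (x : nat) : {set 'I_n} := (pdecode n x).1.

Definition pbelow n (x : nat) : {fset nat} := (pdecode n x).2.

Definition ple n (x y : nat) : bool := (x \in pbelow n y) || (x == y).

Lemma pval_code n (b : {set 'I_n}) Y : pval n (pcode b Y) = b.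
Proof. by rewrite /pval /pdecode /pcode choice.pickleK. Qed.

Lemma pbelow_code n (b : {set 'I_n}) Y : pbelow n (pcode b Y) = Y.
Proof. by rewrite /pbelow /pdecode /pcode choice.pickleK. Qed.

(* The conditions on (b, Y) for w_{b,Y} to be a point of K^d \ K^(d-1), where
   A = K^(d-1) and B = K^(d-2), with B = None when d = 0. *)
Definition admissible n (A : {fset nat}) (B : option {fset nat})
    (b : {set 'I_n}) (Y : {fset nat}) : bool :=
  [&& (Y `<=` A)%fset,
      [forall y : Y, forall x : A, ple n (val x) (val y) ==> (val x \in Y)],
      (if B is Some B' then ~~ (Y `<=` B')%fset else true),
      [forall y : Y, b \subset pval n (val y)] &
      [forall w : A, (Y == [fset x in A | ple n x (val w)]%fset) ==>
                     (b != pval n (val w))]].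

(* Indices are shifted by one: stage n d is K_n^(d-1), stage n 0 is K_n^(-1). *)
Fixpoint stage n (d : nat) : {fset nat} :=
  if d is d1.+1 then
    let A := stage n d1 in
    let B := if d1 is d2.+1 then Some (stage n d2) else None in
    (A `|` [fset pcode b Y | b : {set 'I_n}, Y in fpowerset A
                           & admissible A B b Y])%fset
  else fset0.

Definition Kpred n : {pred nat} := fun x => `[< exists d, x \in stage n d >].

Record K n : Type := KPoint { kcode : nat; kcodeP : kcode \in @Kpred n }.
Arguments KPoint {n}.

HB.instance Definition _ n := [isSub for @kcode n].
HB.instance Definition _ n := [Choice of K n by <:].

Definition Kval n (w : K n) : {set 'I_n} := pval n (kcode w).

Definition Kle n (v w : K n) : bool := ple n (kcode v) (kcode w).

Lemma stage_new n d x : x \in stage n d ->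
  exists e (b : {set 'I_n}) Y, [/\ (e < d)%N, x = pcode b Y,
    admissible (stage n e) (if e is e'.+1 then Some (stage n e') else None) b Y &
    pcode b Y \in stage n e.+1].
Proof.
elim: d => [//|d IH]; rewrite in_fsetU => /orP[/IH|].
  by move=> [e [b [Y [ed h1 h2 h3]]]]; exists e, b, Y; split=> //; apply: ltnW.
move=> hx; have xS : x \in stage n d.+1 by rewrite in_fsetU hx orbT.
have /imfset2P[b _ [Y]] := hx.
rewrite inE => /andP[_ adm] xE; exists d, b, Y; split=> //.
by rewrite -xE.
Qed.

Lemma stage_mono n d e x : (d <= e)%N -> x \in stage n d -> x \in stage n e.
Proof.
move=> /subnKC <-; elim: (e - d)%N => [|k IH]; first by rewrite addn0.
by move=> /IH; rewrite addnS in_fsetU => ->.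
Qed.

Lemma stage_below n d x y :
  x \in stage n d.+1 -> y \in pbelow n x -> y \in stage n d.
Proof.
move=> /stage_new[e [b [Y [ed -> /and5P[/fsubsetP sY _ _ _ _] _]]]].
by rewrite pbelow_code => /sY; apply: stage_mono.
Qed.

Lemma stageD n d x : x \in (stage n d.+1 `\` stage n d)%fset <->
  exists (b : {set 'I_n}) Y, x = pcode b Y /\
    admissible (stage n d) (if d is d'.+1 then Some (stage n d') else None) b Y.
Proof.
split.
  rewrite in_fsetD in_fsetU => /andP[/negbTE-> /= /imfset2P[b _ [Y]]].
  by rewrite inE => /andP[_ adm] ->; exists b, Y.
move=> [b [Y [-> adm]]]; rewrite in_fsetD in_fsetU.
apply/andP; split; last first.
  apply/orP; right; apply/imfset2P; exists b => //; exists Y => //.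
  by rewrite inE fpowersetE adm andbT; case/and5P: adm.
apply/negP => /stage_new[e [b' [Y' [ed E /and5P[/fsubsetP sY _ _ _ _] _]]]].
have {E} EY : Y = Y' by rewrite -(pbelow_code b Y) E pbelow_code.
case: d ed adm => [//|d] ed /and5P[_ _ nYB _ _]; move/negP: nYB; apply.
by apply/fsubsetP => y; rewrite EY => /sY; apply: stage_mono.
Qed.

Lemma below_trans n d x y z : z \in stage n d ->
  x \in pbelow n y -> y \in pbelow n z -> x \in pbelow n z.
Proof.
move=> /stage_new[e [b [Y [ed -> /and5P[/fsubsetP sY dY _ _ _] _]]]].
rewrite pbelow_code => xy yY; have yA := sY _ yY.
have xA : x \in stage n e by apply: (stage_below (d := e)) xy; apply: stage_mono yA.
have /forallP/(_ [` yY]%fset)/forallP/(_ [` xA]%fset)/= := dY.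
by rewrite /ple xy => /implyP; apply.
Qed.

Lemma below_asym n d x y :
  x \in stage n d -> x \in pbelow n y -> y \in pbelow n x -> False.
Proof.
elim: d x y => [//|d IH] x y xS xy yx.
exact: (IH y x (stage_below xS yx) yx xy).
Qed.

Lemma Kle_refl n : reflexive (@Kle n).
Proof. by move=> x; rewrite /Kle /ple eqxx orbT. Qed.

Lemma Kle_anti n : antisymmetric (@Kle n).
Proof.
move=> x y; rewrite /Kle /ple => /andP[/orP[xy|/eqP xy] /orP[yx|/eqP yx]];
  apply: val_inj => //.
have /asboolP[d xS] := kcodeP x.
by case: (below_asym xS xy yx).
Qed.

Lemma Kle_trans n : transitive (@Kle n).
Proof.
move=> y x z; rewrite /Kle /ple => /orP[xy|/eqP-> //] /orP[yz|/eqP<-].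
  by have /asboolP[d zS] := kcodeP z; rewrite (below_trans zS xy yz).
by rewrite xy.
Qed.

Fact K_display : Order.disp_t. Proof. exact: Order.Disp tt tt. Qed.

HB.instance Definition _ n :=
  Order.Le_isPOrder.Build K_display (K n) (@Kle_refl n) (@Kle_anti n) (@Kle_trans n).

Lemma Kval_mono n (v w : K n) : v <= w -> Kval w \subset Kval v.
Proof.
rewrite /Order.le /= /Kle /ple /Kval => /orP[vw|/eqP-> //].
have /asboolP[d /stage_new[e [b [Y [_ wE /and5P[_ _ _ bY _] _]]]]] := kcodeP w.
move: vw; rewrite wE pbelow_code pval_code => vY.
by have /forallP/(_ [` vY]%fset) := bY.
Qed.

Definition Fhat n := downset (K n).

Lemma ghat_subproof n (j : 'I_n) :
  [set w : K n | j \in Kval w] \in @decreasing_pred _ (K n).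
Proof. by apply/asboolP => v w /Kval_mono/fintype.subsetP; apply. Qed.

Definition ghat n (j : 'I_n) : Fhat n := Downset _ (ghat_subproof j).

(* By Bellissima's theorem, F n is the free Heyting algebra on the fgen j. *)
Definition F n := gen_subalg (range (@ghat n)).

Definition fgen n (j : 'I_n) : F n := gen_in (imageT (@ghat n) j).

Definition order_iso_onto d (P : porderType d) T (f : P -> set T)
    (S : set (set T)) : Prop :=
  set_bij setT S f /\ forall v w : P, v <= w <-> f v `<=` f w.

(* Main.v *)
(* A meet-prime downset [x <> setT] of a well-founded order has a unique minimal
   non-element [w], and then [x = ~` Up w]; the argument only uses meets,
   implications and the sets [~` Up w], so it applies to every Heyting subalgebra
   containing these. That the subalgebra generated by the [ghat j] contains them
   is shown by well-founded induction on [w] with the de Jongh formulas, which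
   define [~` Up w] and the downset of [w] from those of the points below [w]. *)

Require Import Defs.
From mathcomp Require Import all_boot all_order finmap.
From mathcomp Require Import boolp classical_sets functions.

Set Implicit Arguments.
Unset Strict Implicit.
Unset Printing Implicit Defensive.

Import Order.TTheory.
Local Open Scope order_scope.
Local Open Scope classical_set_scope.

(** * Minimal elements and pointwise membership in downsets *)

Lemma wf_minimal d (P : porderType d) (A : set P) :
  well_founded (fun v w : P => v < w) -> A !=set0 ->
  exists2 w, A w & forall v, v < w -> ~ A v.
Proof.
move=> wfP [x]; elim/(well_founded_ind wfP): x => x IH Ax.
have [[v [vx Av]]|nex] := pselect (exists v, v < x /\ A v); first exact: IH vx Av.
by exists x => // v vx Av; apply: nex; exists v.
Qed.

Lemma downset_le d (P : porderType d) (a : downset P) x y :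
  x <= y -> down_val a y -> down_val a x.
Proof. by have /asboolP := down_valP a; apply. Qed.

Lemma leDownset d (P : porderType d) (a b : downset P) :
  a <= b <-> down_val a `<=` down_val b.
Proof. by rewrite -Order.le_val -subsetEset. Qed.

Lemma downset_ext d (P : porderType d) (a b : downset P) :
  (forall v, down_val a v <-> down_val b v) -> a = b.
Proof.
by move=> ab; apply/val_inj/seteqP; split=> v; apply ab.
Qed.

Lemma in_downI d (P : porderType d) (a b : downset P) v :
  down_val (Order.meet a b) v <-> down_val a v /\ down_val b v.
Proof. by []. Qed.

Lemma in_downU d (P : porderType d) (a b : downset P) v :
  down_val (Order.join a b) v <-> down_val a v \/ down_val b v.
Proof. by []. Qed.

Lemma in_down0 d (P : porderType d) v : ~ down_val (\bot : downset P) v.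
Proof. by []. Qed.

Lemma in_down1 d (P : porderType d) v : down_val (\top : downset P) v.
Proof. by []. Qed.

(** This is the Kripke forcing clause for implication with the order reversed: the future of a point
    is what lies below it. *)
Lemma in_down_himp d (P : porderType d) (a b : downset P) v :
  down_val (himp a b) v <->
  forall u, u <= v -> down_val a u -> down_val b u.
Proof.
split=> [abv u uv au|h].
  have /leDownset/(_ u) : Order.meet (himp a b) a <= b by rewrite -himpP.
  by apply; apply/in_downI; split=> //; apply: downset_le uv abv.
(* The principal downset of [v] witnesses membership in the union defining [himp]. *)
exists [set u | u <= v]; last exact: lexx.
split=> [x y xy yv|u uv]; first exact: le_trans xy yv.
by have [au|nau] := pselect (down_val a u); [right; apply: h|left].
Qed.

Lemma in_down_join d (P : porderType d) (I : eqType) (r : seq I) (p : pred I)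
    (f : I -> downset P) v :
  down_val (\join_(i <- r | p i) f i) v <->
  exists i, [/\ i \in r, p i & down_val (f i) v].
Proof.
elim: r => [|i r IH].
  by rewrite big_nil; split=> [/in_down0//|[i []]].
rewrite big_cons; split=> [|[j [+ pj fj]]].
  case: ifP => pi; last first.
    by move/IH=> [j [jr pj fj]]; exists j; rewrite inE jr orbT.
  case/in_downU => [fi|/IH[j [jr pj fj]]]; first by exists i; rewrite mem_head.
  by exists j; rewrite inE jr orbT.
rewrite inE => /orP[/eqP ij|jr].
  by rewrite -ij pj; apply/in_downU; left.
have jv : down_val (\join_(i <- r | p i) f i) v by apply/IH; exists j.
by case: ifP => // _; apply/in_downU; right.
Qed.

Lemma in_down_meet d (P : porderType d) (I : finType) (p : pred I)
    (f : I -> downset P) v :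
  down_val (\meet_(i | p i) f i) v <-> forall i, p i -> down_val (f i) v.
Proof.
split=> [h i pi|h].
  by have /leDownset := meets_inf f pi; apply.
by elim/big_ind: _.
Qed.

(** * Principal prime ideals and the sets [compl_Up w] *)

Lemma lower_subproof d (P : porderType d) (w : P) :
  [set v | v <= w] \in @decreasing_pred d P.
Proof. by apply/asboolP => x y xy yw; apply: le_trans xy yw. Qed.

Definition lower d (P : porderType d) (w : P) : downset P :=
  Downset _ (lower_subproof w).

Lemma le_compl_Up d (P : porderType d) (a : downset P) (w : P) :
  a <= compl_Up w <-> ~ down_val a w.
Proof.
split=> [/leDownset/(_ w) h aw|naw]; first by apply: (h aw); apply: lexx.
by apply/leDownset => v av wv; apply: naw; apply: downset_le wv av.
Qed.

(* For [x] meet-prime and [w] minimal outside [x], minimality gives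
   [w \in (m w -> x)], so [m w <= x] follows from primeness of [x] and
   [m w /\ (m w -> x) <= x]. *)
Lemma Spec0_order_iso d d' (P : porderType d) (H : heytingType d')
    (e : H -> downset P) (m : P -> H) :
  well_founded (fun v w : P => v < w) ->
  (forall a b, (e a <= e b) = (a <= b)) ->
  {morph e : a b / Order.meet a b} -> {morph e : a b / himp a b} ->
  e \top = \top -> (forall w, e (m w) = compl_Up w) ->
  order_iso_onto (fun w => principal_ideal (m w)) (Spec0 H).
Proof.
move=> wfP e_le eI eH e1 em.
have le_m a w : a <= m w <-> ~ down_val (e a) w.
  by rewrite -e_le em; apply: le_compl_Up.
have m_mono v w : v <= w <-> principal_ideal (m v) `<=` principal_ideal (m w).
  split=> [vw a /= /le_m av|/(_ (m v)) /= h].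
    by apply/le_m; apply: contra_not av; apply: downset_le.
  by have /le_m := h (lexx _); rewrite em => /contrapT.
split=> //; split=> [w _|v w _ _ vw|I [[_ _ Iprime] [x xN1 Ix]]].
- split; last first.
    exists (m w) => // mw1; have : \top <= m w by rewrite mw1.
    by move/le_m; apply; rewrite e1; apply: in_down1.
  split=> [|/le_m|a b /le_m]; last 2 first.
  + by apply; rewrite e1; apply: in_down1.
  + rewrite eI => nab; have [aw|naw] := pselect (down_val (e a) w).
      by right; apply/le_m => bw; apply: nab; apply/in_downI.
    by left; apply/le_m.
  split=> [|a b aw bw|a b ab bw]; rewrite /principal_ideal /=.
  + exact: le0x.
  + by rewrite leUx aw bw.
  + exact: le_trans ab bw.
- by apply/le_anti/andP; split; apply/m_mono; rewrite vw.
(* Some point lies outside [e x]: otherwise [x] would be [\top], because [e] reflects the order. *)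
- have [|w /= nxw xlt] := @wf_minimal _ _ [set w | ~ down_val (e x) w] wfP.
    apply: contrapT => nex; apply: xN1; apply/le_anti; rewrite lex1 -e_le.
    apply/leDownset => v _; apply: contrapT => nxv.
    by apply: nex; exists v.
  exists w => //; rewrite Ix; congr principal_ideal.
  apply/le_anti/andP; split; last exact/le_m.
  have : I (Order.meet (m w) (himp (m w) x)).
    by rewrite Ix /principal_ideal /= meetC -himpP lexx.
  move/Iprime; rewrite Ix /principal_ideal /= => -[//|].
  rewrite -e_le => /leDownset/(_ w) h; exfalso; apply: nxw; apply: h.
  rewrite eH; apply/in_down_himp => u uw; rewrite em => nwu.
  apply: contrapT; apply: xlt; rewrite lt_neqAle uw andbT.
  by apply/eqP => uE; apply: nwu; rewrite uE; apply: lexx.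
Qed.

(** * Well-foundedness and extensionality of the generic model *)

Lemma ltK n (v w : K n) : (v < w) = (kcode v \in pbelow n (kcode w)).
Proof.
rewrite lt_neqAle [v <= w]/(ple n (kcode v) (kcode w)) /ple.
have [->|vw] /= := eqVneq v w; last first.
  by rewrite -(inj_eq val_inj) /= in vw; rewrite (negbTE vw) orbF.
apply/esym/negP => ww; have /asboolP[d wS] := kcodeP w.
exact: (below_asym wS ww ww).
Qed.

(** Induction on the stage: passing strictly below a point lowers the stage by one. *)
Lemma K_wf n : well_founded (fun v w : K n => v < w).
Proof.
move=> w; have /asboolP[d] := kcodeP w.
elim: d w => [//|d IH] w wS; constructor=> v; rewrite ltK => vw.
exact: IH (stage_below wS vw).
Qed.

Lemma Kpred_below n (w : K n) x : x \in pbelow n (kcode w) -> x \in @Kpred n.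
Proof.
have /asboolP[[//|d] wS] := kcodeP w => xw.
by apply/asboolP; exists d; apply: stage_below xw.
Qed.

Lemma K_ext n (v w : K n) :
  Kval v = Kval w -> (forall u, (u < v) = (u < w)) -> v = w.
Proof.
move=> vw_val vw_lt; apply: val_inj => /=.
have : pbelow n (kcode v) = pbelow n (kcode w).
  apply/fsetP => x; apply/idP/idP => xin.
    by have := vw_lt (KPoint x (Kpred_below xin)); rewrite !ltK xin => /esym.
  by have := vw_lt (KPoint x (Kpred_below xin)); rewrite !ltK xin.
move: vw_val; rewrite /Kval.
have /asboolP[d /stage_new[e [b [Y [_ -> _ _]]]]] := kcodeP v.
have /asboolP[d' /stage_new[e' [b' [Y' [_ -> _ _]]]]] := kcodeP w.
by rewrite !pval_code !pbelow_code => -> ->.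
Qed.

(** This is condition (iii) of the construction: the set [Y] coded in [v] is the downset generated
    by [w]. *)
Lemma Kval_cover n (v w : K n) :
  (forall u, (u < v) = (u <= w)) -> Kval v <> Kval w.
Proof.
move=> lt_v.
have /asboolP[d /stage_new[e [b [Y [_ vE /and5P[/fsubsetP sY _ _ _ cov] _]]]]] :=
  kcodeP v.
have below_v : pbelow n (kcode v) = Y by rewrite vE pbelow_code.
have wY : kcode w \in Y by rewrite -below_v -ltK lt_v.
have /forallP/(_ [` sY _ wY]%fset)/implyP/= := cov.
rewrite /Kval vE pval_code => h; apply/eqP; apply: h; apply/eqP/fsetP => x.
(* [admissible] forms the generated downset inside stage [e] only; it still equals [Y], which lies
   in that stage. *)
rewrite !inE /=; apply/idP/andP => [xY|[xA xw]].
  split; first exact: sY.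
  have xK : x \in @Kpred n by apply: (@Kpred_below _ v); rewrite below_v.
  by have := lt_v (KPoint x xK); rewrite ltK below_v xY => /esym.
have xK : x \in @Kpred n by apply/asboolP; exists e.
by have := lt_v (KPoint x xK); rewrite ltK below_v /= => ->.
Qed.

(** * De Jongh formulas *)

Definition strict_lower n (w : K n) : seq (K n) := pmap insub (pbelow n (kcode w)).

Lemma mem_strict_lower n (v w : K n) : (v \in strict_lower w) = (v < w).
Proof. by rewrite mem_pmap_sub ltK. Qed.

(** Written as a finite join so that it stays in any Heyting subalgebra containing each
    [lower y]. *)
Definition lower_proper n (w : K n) : Fhat n := \join_(y <- strict_lower w) lower y.

Lemma in_lower_proper n (w v : K n) : down_val (lower_proper w) v <-> v < w.
Proof.
split=> [/in_down_join[y [+ _ vy]]|vw].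
  by rewrite mem_strict_lower; apply: le_lt_trans vy.
by apply/in_down_join; exists v; rewrite mem_strict_lower; split=> //; apply: lexx.
Qed.

(* De Jongh's formula: [v] satisfies the right-hand side iff [Kval w \subset Kval v]
   and every [u <= v] not strictly below [w] has the valuation of [w] and lies above
   all points strictly below [w]. A minimal such [u] equals [w] by [K_ext]; a minimal
   one outside [lower w] would cover exactly [w], against [Kval_cover]. *)
Lemma lowerE n (w : K n) :
  lower w = Order.meet (\meet_(j in Kval w) ghat j)
    (himp (Order.join (\join_(j | j \notin Kval w) ghat j)
                      (\join_(y <- strict_lower w) compl_Up y))
          (lower_proper w)).
Proof.
apply: downset_ext => v; split=> [vlw|/in_downI[vwb vh]].
  have {vlw} vw : v <= w := vlw.
  apply/in_downI; split.
    by apply/in_down_meet => j jw; apply: fintype.subsetP (Kval_mono vw) j jw.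
  apply/in_down_himp => u uv uQ; apply/in_lower_proper.
  (* The point [w] itself falsifies both disjuncts of the antecedent, so [u] differs from [w]. *)
  rewrite lt_neqAle (le_trans uv vw) andbT; apply/eqP => uw.
  case/in_downU: uQ => /in_down_join[]; rewrite uw => i [].
    by move=> _ /negP.
  by rewrite mem_strict_lower => /ltW iw _ /= /(_ iw).
have vb : Kval w \subset Kval v.
  by apply/fintype.subsetP => j jw; have /in_down_meet/(_ j jw) := vwb.
(* Such a [u] lies outside the conclusion of the implication, hence falsifies both disjuncts of its
   antecedent. *)
have out u : u <= v -> ~ u < w ->
    Kval u = Kval w /\ forall y, y < w -> y <= u.
  move=> uv nuw; split.
    apply/eqP; rewrite finset.eqEsubset (fintype.subset_trans vb (Kval_mono uv)) andbT.
    apply/fintype.subsetP => j ju; apply: contrapT => /negP jw; apply: nuw.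
    apply/in_lower_proper; have /in_down_himp := vh; apply=> //.
    by apply/in_downU; left; apply/in_down_join; exists j.
  move=> y yw; apply: contrapT => /negP nyu; apply: nuw.
  apply/in_lower_proper; have /in_down_himp := vh; apply=> //.
  apply/in_downU; right; apply/in_down_join; exists y.
  by rewrite mem_strict_lower; split=> //; apply/negP.
have minE u : u <= v -> ~ u < w -> (forall x, x < u -> x < w) -> u = w.
  move=> uv nuw ult; have [uval wu] := out u uv nuw.
  apply: K_ext => // x; apply/idP/idP => [/ult//|xw].
  rewrite lt_neqAle wu // andbT; apply/eqP => xu.
  by apply: nuw; rewrite -xu.
have geW u : u <= v -> ~ u < w -> w <= u.
  move=> uv nuw.
  have [|x [xu nxw] xmin] := @wf_minimal _ _ [set x | x <= u /\ ~ x < w] (@K_wf n).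
    by exists u.
  rewrite -(minE x) //; first exact: le_trans xu uv.
  move=> y yx; apply: contrapT => nyw; apply: (xmin y yx); split=> //.
  exact: le_trans (ltW yx) xu.
have [vw|nvw] := pselect (v < w); first exact: ltW.
apply: contrapT => /= /negP nvlew.
have [|u [uv nuw] umin] := @wf_minimal _ _ [set u | u <= v /\ ~ u <= w] (@K_wf n).
  by exists v; split=> //; apply/negP.
have nultw : ~ u < w by move/ltW.
have [uval _] := out u uv nultw.
(* Points strictly below [u] are below [w] by minimality of [u]; conversely [geW] gives [w < u]. *)
apply: (@Kval_cover _ u w) uval => x; apply/idP/idP => [xu|xw].
  apply: contrapT => nxw; apply: (umin x xu); split=> //.
  exact: le_trans (ltW xu) uv.
apply: le_lt_trans xw _; rewrite lt_neqAle geW // andbT.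
by apply/eqP => wu; apply: nuw; rewrite wu; apply: lexx.
Qed.

(** Only [w] is in [lower w] but not in [lower_proper w], so the implication fails at [v] exactly
    when [w <= v]. *)
Lemma compl_UpE n (w : K n) : compl_Up w = himp (lower w) (lower_proper w).
Proof.
apply: downset_ext => v; split=> [nwv|/in_down_himp h wv].
  apply/in_down_himp => u uv /= uw; apply/in_lower_proper.
  rewrite lt_neqAle uw andbT; apply/eqP => uE.
  by apply: nwv; rewrite /Up /= -uE.
by have /in_lower_proper := h w wv (lexx w); rewrite ltxx.
Qed.

(** * Definability from the generators, and the theorem *)

Lemma heyting_closed_join n (S : set (Fhat n)) (I : eqType) (r : seq I)
    (p : pred I) (f : I -> Fhat n) :
  heyting_closed S -> (forall i, i \in r -> p i -> S (f i)) ->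
  S (\join_(i <- r | p i) f i).
Proof.
move=> [S0 _ _ SU _] Sf; rewrite big_seq_cond.
by elim/big_ind: _ => // i /andP[]; apply: Sf.
Qed.

(** Both memberships are proved together because [lowerE] at [w] uses [lower y] and [compl_Up y] for
    all [y < w]. *)
Lemma heyting_closed_lower n (S : set (Fhat n)) (w : K n) :
  heyting_closed S -> (forall j, S (ghat j)) -> S (lower w) /\ S (compl_Up w).
Proof.
move=> Scl Sg; have [S0 S1 SI SU SH] := Scl.
elim/(well_founded_ind (@K_wf n)): w => w IH.
have Sproper : S (lower_proper w).
  by apply: heyting_closed_join => // y; rewrite mem_strict_lower => /IH[].
have Slower : S (lower w).
  rewrite lowerE; apply: (SI); first exact: (big_ind S).
  apply: (SH) => //; apply: SU; first exact: heyting_closed_join.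
  by apply: heyting_closed_join => // y; rewrite mem_strict_lower => /IH[].
by split=> //; rewrite compl_UpE; apply: SH.
Qed.

Lemma compl_Up_gen n (w : K n) :
  (compl_Up w : Fhat n) \in gen_pred (range (@ghat n)).
Proof.
apply/asboolP; apply: (heyting_closed_lower w (gen_closed _) _).2 => j.
exact: sub_gen_smallest (imageT _ j).
Qed.

Lemma le_compl_Up_ghat n (w : K n) (j : 'I_n) :
  j \in Kval w <-> ~ (ghat j <= compl_Up w).
Proof.
split=> [jw /le_compl_Up//|h]; apply: contrapT => njw.
by apply: h; apply/le_compl_Up.
Qed.

Theorem theorem5p7 (n : nat) (n_ge1 : (1 <= n)%N) :
  (exists m : K n -> F n,
     (forall w : K n, gen_val (m w) = compl_Up w) /\
     let phi := fun w : K n => principal_ideal (m w) in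
     order_iso_onto phi (Spec0 (F n)) /\
     (forall (I : set (F n)), Spec0 (F n) I ->
      forall w : K n, phi w = I ->
      forall j : 'I_n,
        (j \in Kval w <-> ~ I (fgen j)) /\
        (j \in Kval w <-> Ibar0 (fgen j) I))) /\
  (let phihat := fun w : K n => principal_ideal (compl_Up w : Fhat n) in
   order_iso_onto phihat (Spec0 (Fhat n)) /\
   (forall (I : set (Fhat n)), Spec0 (Fhat n) I ->
    forall w : K n, phihat w = I ->
    forall j : 'I_n,
      (j \in Kval w <-> ~ I (ghat j)) /\
      (j \in Kval w <-> Ibar0 (ghat j) I))).
Proof.
split.
  exists (fun w => GenSubalg _ (compl_Up_gen w)); split; first by move=> w.
  split.
    (* The subalgebra inherits its order and operations, so the inclusion [gen_val] meets the
       requirements on [e]. *)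
    apply: (@Spec0_order_iso _ _ _ (F n) (@gen_val _ _ _)).
    - exact: K_wf.
    - by move=> a b; rewrite -Order.le_val.
    - by move=> a b.
    - by move=> a b.
    - by [].
    - by move=> w.
  move=> I SI w phiw j.
  have jw : j \in Kval w <-> ~ I (fgen j).
    by rewrite -phiw /principal_ideal /mkset -Order.le_val; apply: le_compl_Up_ghat.
  by split=> //; split=> [/jw nI|[_ /jw]].
split.
  apply: (@Spec0_order_iso _ _ _ (Fhat n) id); first exact: K_wf.
  - by move=> a b.
  - by move=> a b.
  - by move=> a b.
  - by [].
  - by move=> w.
move=> I SI w phiw j.
have jw : j \in Kval w <-> ~ I (ghat j).
  by rewrite -phiw; apply: le_compl_Up_ghat.
by split=> //; split=> [/jw nI|[_ /jw]].
Qed.
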